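(* Let $\Delta,k,t\ge0$ be integers and let $G$ be a graph of maximum degree at most $\Delta$ with no $(k,t)$-creature. Let $X\subseteq V(G)$ induce a graph isomorphic to $S_{t+1,t+1,t+1}$, and let $x$ be a leaf of $X$. Then the connected component of $G\setminus(N[X\setminus\{x\}]\setminus\{x\})$ containing $x$ contains no $(k-1,t(1+\Delta))$-creature.
   Context: $S_{a,a,a}$ consists of a root $v$ and three paths of length $a$ (number of edges) with one end $v$, whose vertex sets minus $v$ are pairwise disjoint and anticomplete; a leaf is a vertex of degree one. $N[Z]$ is the closed neighbourhood of $Z$. For integers $k>0$, $t\ge0$, a $(k,t)$-creature in a graph $G$ is a pair $(J,\mathcal{P})$ where $J\subseteq V(G)$ is connected, $\mathcal{P}$ is a collection of $k$ pairwise vertex-disjoint and pairwise anticomplete induced paths in $G\setminus J$, each of length $t$, and for every $P\in\mathcal{P}$ some end $v$ of $P$ (the $P$-joint) has a neighbour in $J$ while $V(P)\setminus\{v\}$ is anticomplete to $J$. A graph contains a creature if such a pair exists in it. *)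

(* Defs.v *)
From mathcomp Require Import all_boot.

Set Implicit Arguments.
Unset Strict Implicit.
Unset Printing Implicit Defensive.

(** Graphs are finite and simple. *)
Record sgraph := SGraph {
  vertex :> finType;
  adj : rel vertex;
  adj_sym : symmetric adj;
  adj_irrefl : irreflexive adj }.

Arguments adj {s} : rename.

Definition isomorphic (G H : sgraph) : Prop :=
  exists2 f : G -> H, bijective f & {mono f : x y / adj x y}.

Section Induced.
Variables (G : sgraph) (A : {set G}).

Definition induced_adj : rel {x : G | x \in A} :=
  [rel u v | adj (val u) (val v)].

Fact induced_sym : symmetric induced_adj.
Proof. by move=> u v; apply: adj_sym. Qed.

Fact induced_irrefl : irreflexive induced_adj.
Proof. by move=> u; apply: adj_irrefl. Qed.

Definition induced : sgraph := SGraph induced_sym induced_irrefl.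

End Induced.

Section SubdividedClaw.
Variable a : nat.

(** [None] is the root; [Some (i, j)] is the vertex of the [i]-th path
    at distance [j.+1] from the root. *)
Definition claw_adj (u v : option ('I_3 * 'I_a)) : bool :=
  match u, v with
  | None, None => false
  | None, Some p | Some p, None => p.2 == 0 :> nat
  | Some p, Some q =>
      (p.1 == q.1) && ((p.2.+1 == q.2 :> nat) || (q.2.+1 == p.2 :> nat))
  end.

Fact claw_sym : symmetric claw_adj.
Proof. by move=> [p|] [q|] //=; rewrite eq_sym orbC. Qed.

Fact claw_irrefl : irreflexive claw_adj.
Proof. by move=> [p|] //=; rewrite orbb gtn_eqF ?andbF. Qed.

Definition subdivided_claw : sgraph := SGraph claw_sym claw_irrefl.

End SubdividedClaw.

Section Graph.
Variable G : sgraph.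
Implicit Types (A B J X Z : {set G}) (v x : G).

Definition nbh v : {set G} := [set w | adj v w].

Definition closed_nbh Z : {set G} := Z :|: \bigcup_(z in Z) nbh z.

Definition max_degree_le (D : nat) : Prop := forall v, #|nbh v| <= D.

Definition anticomplete A B : Prop :=
  forall a b, a \in A -> b \in B -> ~~ adj a b.

Definition connected A : Prop :=
  A != set0 /\ {in A &, forall u v, connect [rel u v in A | adj u v] u v}.

(** The vertex set of the component of [G[A]] containing [x], for [x \in A]. *)
Definition component A x : {set G} :=
  [set y | connect [rel u v in A | adj u v] x y].

Definition leaf X x : Prop := x \in X /\ #|nbh x :&: X| = 1.

(** Injectivity is not implied by the adjacency condition: consider [u, v, u]. *)
Definition induced_path t (p : t.+1.-tuple G) : Prop :=
  uniq p /\
  forall i j,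
    adj (tnth p i) (tnth p j) = (i.+1 == j :> nat) || (j.+1 == i :> nat).

Definition path_end t (p : t.+1.-tuple G) v : Prop :=
  v = tnth p ord0 \/ v = tnth p ord_max.

(** A path of length [t] has [t.+1] vertices.  The paths are pairwise disjoint
    and nonempty, so the family [P] is a collection of exactly [k] paths.
    For [k = 0] the conditions on [P] are void, so every nonempty graph
    contains a [(0, t)]-creature. *)
Definition creature k t J (P : 'I_k -> t.+1.-tuple G) : Prop :=
  [/\ connected J,
      forall i, induced_path (P i) /\ [disjoint [set:: P i] & J],
      forall i j, i != j ->
        [disjoint [set:: P i] & [set:: P j]] /\
        anticomplete [set:: P i] [set:: P j]
    & forall i, exists v,
        [/\ path_end (P i) v,
            exists2 w, w \in J & adj v w
          & anticomplete ([set:: P i] :\ v) J]].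

Definition contains_creature k t : Prop :=
  exists J (P : 'I_k -> t.+1.-tuple G), creature J P.

End Graph.

Arguments max_degree_le : clear implicits.
Arguments contains_creature : clear implicits.

(* Main.v *)
Require Import Defs.
From mathcomp Require Import all_boot zify.

(** Let [x] be the end of one leg of the claw, and walk inside the component from
    [x] until the first vertex [q] in the closed neighbourhood of the given
    creature [(J, P)].  Enlarge [J] by the root, the leg of [x] and the walk.  If
    [q] touches [J] but lies on no path of [P], another leg of the claw is the
    additional path.  Otherwise some path of [P] is absorbed as well, in order to
    connect [q] to [J], and the two other legs make up for it.  A remaining path
    has at most [1 + D] vertices with a neighbour in the enlarged set, namely its
    joint and neighbours of [q]; as it has [t * (1 + D) + 1] vertices, some
    [t + 1] consecutive ones contain such a vertex only at the beginning. *)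

Set Implicit Arguments.
Unset Strict Implicit.
Unset Printing Implicit Defensive.

(** * Sparse marks in an interval *)

(** Pigeonhole by induction on [s]. If the last [t] positions contain a mark, dropping them lowers
    the count by at least one. If not, the last mark among the remaining positions is followed by
    [t] unmarked ones. *)
Lemma marked_gap (m : pred nat) (t s : nat) :
  m 0 -> count m (iota 0 (t * s).+1) <= s ->
  exists a, [/\ a + t <= t * s, m a & forall j, 0 < j <= t -> ~~ m (a + j)].
Proof.
move=> m0; elim: s => [|s IHs] /=; first by rewrite m0.
have -> : t * s.+1 = t * s + t by rewrite mulnS addnC.
rewrite -[count m (iota 1 _) in X in X -> _]/(count m (iota 1 (t * s + t))).
rewrite iotaD count_cat add1n => le_s.
have [m_last|] := boolP (has m (iota (t * s).+1 t)).
  have [|a [ale ma gap]] := IHs; last by exists a; split=> //; lia.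
  rewrite /=; move: m_last; rewrite has_count; lia.
move=> /hasPn no_last.
have exm : exists a, (a <= t * s) && m a by exists 0.
have bm a : (a <= t * s) && m a -> a <= t * s by case/andP.
case: (ex_maxnP exm bm) => a /andP[ale ma] amax; exists a; split=> //.
  by rewrite leq_add2r.
move=> j /andP[j0 jt]; apply/negP => maj.
have [aj|aj] := leqP (a + j) (t * s).
  have := amax (a + j); rewrite aj maj => /(_ isT); lia.
by have := no_last (a + j); rewrite mem_iota maj => /(_ _)/implyP; lia.
Qed.

Section Graphs.
Variable G : sgraph.
Implicit Types (A B J X : {set G}) (x y : G).

(** * Connected vertex sets *)

Lemma connected_via A x :
  x \in A -> {in A, forall y, connect [rel u v in A | adj u v] y x} ->
  connected A.
Proof.
move=> xA cx; split; first by apply/set0Pn; exists x.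
have sym : connect_sym [rel u v in A | adj u v].
  by apply: sym_connect_sym => u v /=; rewrite adj_sym (andbC (u \in A)).
by move=> u v uA vA; apply: connect_trans (cx u uA) _; rewrite sym cx.
Qed.

Lemma connected1 x : connected [set x].
Proof. by apply: (@connected_via _ x); rewrite ?set11 // => y /set1P->. Qed.

Lemma connect_setS A B x y : A \subset B ->
  connect [rel u v in A | adj u v] x y -> connect [rel u v in B | adj u v] x y.
Proof.
move=> sAB; apply: connect_sub => u v /andP[/andP[uA vA] uv].
by apply: connect1; rewrite /= !(subsetP sAB).
Qed.

Lemma connectedU A B a b : connected A -> connected B ->
  a \in A -> b \in B -> (a == b) || adj a b -> connected (A :|: B).
Proof.
move=> [_ cA] [_ cB] aA bB ab; apply: (@connected_via _ b).
  by rewrite inE bB orbT.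
have cab : connect [rel u v in A :|: B | adj u v] a b.
  by case/predU1P: ab => [->//|ab]; apply: connect1; rewrite /= !inE aA bB orbT.
move=> y /setUP[yA|yB]; last exact/(connect_setS (subsetUr A B))/cB.
by apply: connect_trans cab; exact/(connect_setS (subsetUl A B))/cA.
Qed.

(** * Paths attached to a set *)

(** The creature conditions that involve one path only, isolated so that each path can be
    transferred to a larger set separately. *)
Definition hangs t J (p : t.+1.-tuple G) : Prop :=
  [/\ induced_path p, [disjoint [set:: p] & J]
    & exists v, [/\ path_end p v, exists2 w, w \in J & adj v w
                  & anticomplete ([set:: p] :\ v) J]].

Lemma creatureP k t J (P : 'I_k -> t.+1.-tuple G) :
  creature J P <->
  [/\ connected J, forall i, hangs J (P i)
    & forall i j, i != j -> [disjoint [set:: P i] & [set:: P j]] /\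
                            anticomplete [set:: P i] [set:: P j]].
Proof.
split=> [[cJ ind anti jt]|[cJ hg anti]]; split=> // i.
- by have [indi disi] := ind i.
- by case: (hg i).
- by case: (hg i).
Qed.

Lemma anticomplete_sym A B : anticomplete A B -> anticomplete B A.
Proof. by move=> AB b a bB aA; rewrite adj_sym AB. Qed.

Lemma creature_cons k t J (p : t.+1.-tuple G) (P : 'I_k -> t.+1.-tuple G) :
  connected J -> hangs J p -> (forall i, hangs J (P i)) ->
  (forall i, [disjoint [set:: p] & [set:: P i]] /\
             anticomplete [set:: p] [set:: P i]) ->
  (forall i j, i != j -> [disjoint [set:: P i] & [set:: P j]] /\
                         anticomplete [set:: P i] [set:: P j]) ->
  contains_creature G k.+1 t.
Proof.
move=> cJ hp hP pP PP.
exists J, (fun i => if unlift ord0 i is Some j then P j else p).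
apply/creatureP; split=> // [i|i j]; first by case: unliftP.
case: unliftP => [i'|] ->; case: unliftP => [j'|] ->.
- by rewrite (inj_eq lift_inj); apply: PP.
- by move=> _; have [d /anticomplete_sym] := pP i'; rewrite disjoint_sym.
- by move=> _; apply: pP.
- by rewrite eqxx.
Qed.

(** The joint stays the same, since the added vertices neither lie on [p] nor touch it. *)
Lemma hangs_mono t J J' (p : t.+1.-tuple G) :
  hangs J p -> J \subset J' ->
  (forall u w, u \in p -> w \in J' -> w \notin J -> (u != w) && ~~ adj u w) ->
  hangs J' p.
Proof.
move=> [indp dis [v [ev [w wJ vw] anti]]] sJ new; split=> //.
  apply/pred0P => u /=; rewrite inE; apply/negP => /andP[up uJ'].
  have [uJ|uJ] := boolP (u \in J).
    by move/pred0P/(_ u): dis; rewrite /= inE up uJ.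
  by have := new u u up uJ' uJ; rewrite eqxx.
exists v; split=> //; first by exists w => //; apply: (subsetP sJ).
move=> u z; rewrite !inE => /andP[uv up] zJ'.
have [zJ|zJ] := boolP (z \in J); first by apply: anti; rewrite ?inE ?uv.
by case/andP: (new u z up zJ' zJ).
Qed.

(** * Induced paths as sequences, and their segments *)

Lemma induced_path_of_fun t (f : nat -> G) :
  (forall i j, i <= t -> j <= t -> f i = f j -> i = j) ->
  (forall i j, i <= t -> j <= t ->
     adj (f i) (f j) = (i.+1 == j) || (j.+1 == i)) ->
  induced_path [tuple f i | i < t.+1].
Proof.
move=> finj fadj; split.
  by rewrite map_inj_in_uniq ?enum_uniq // => i j _ _ /finj /val_inj-> //;
     rewrite -ltnS.
by move=> i j; rewrite !tnth_mktuple fadj // -ltnS.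
Qed.

(** Numbering a path from its joint, backwards if the joint is the last entry, puts a mark at
    position 0 when the path is cut. Indices in [nat] make shifted segments easy to name. *)
Lemma path_from_end t (p : t.+1.-tuple G) v : induced_path p -> path_end p v ->
  exists f : nat -> G,
  [/\ f 0 = v, (forall i j, i <= t -> j <= t -> f i = f j -> i = j),
      (forall i j, i <= t -> j <= t ->
         adj (f i) (f j) = (i.+1 == j) || (j.+1 == i))
    & (forall u, u \in p <-> exists2 i, i <= t & u = f i)].
Proof.
move=> [up padj] [->|->].
  exists (fun i => tnth p (inord i)); split.
  - by congr tnth; apply: val_inj; rewrite /= inordK.
  - move=> i j it jt /(tuple_uniqP _ up) /(congr1 val); by rewrite /= !inordK.
  - by move=> i j it jt; rewrite padj !inordK.
  move=> u; split=> [/tnthP[i ->]|[i _ ->]]; last exact: mem_tnth.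
  by exists i; rewrite ?inord_val // -ltnS.
exists (fun i => tnth p (inord (t - i))); split.
- by congr tnth; apply: val_inj; rewrite /= inordK ?subn0.
- move=> i j it jt /(tuple_uniqP _ up) /(congr1 val); rewrite /= !inordK; lia.
- move=> i j it jt; rewrite padj !inordK; lia.
move=> u; split=> [/tnthP[i ->]|[i _ ->]]; last exact: mem_tnth.
exists (t - i); first lia.
by congr tnth; apply: val_inj; rewrite /= inordK; have := ltn_ord i; lia.
Qed.

(* The vertices of [p] with a neighbour in [J'] cut [p] into at most [s] blocks
   starting with such a vertex; one block has more than [t] vertices. *)
Lemma hangs_shorten t s J J' (p : (t * s).+1.-tuple G) :
  hangs J p -> J \subset J' -> [disjoint [set:: p] & J'] ->
  #|[set u in p | [exists w in J', adj u w]]| <= s ->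
  exists2 p' : t.+1.-tuple G, hangs J' p' & [set:: p'] \subset [set:: p].
Proof.
move=> [indp _ [v [ev [w wJ vw] _]]] sJ dis cardM.
have [f [f0 finj fadj fp]] := path_from_end indp ev.
pose m i := [exists w in J', adj (f i) w].
have m0 : m 0 by rewrite /m f0; apply/existsP; exists w; rewrite (subsetP sJ).
have [|a [ale ma gap]] := marked_gap (t := t) (s := s) m0.
  apply: leq_trans cardM; rewrite -size_filter -(size_map f) cardE.
  apply: uniq_leq_size.
    rewrite map_inj_in_uniq ?filter_uniq ?iota_uniq // => i j.
    by rewrite !mem_filter !mem_iota => /andP[_ /= it] /andP[_ /= jt] /finj->.
  move=> u /mapP[i]; rewrite mem_filter mem_iota => /andP[mi /= it] ->.
  by rewrite mem_enum inE; apply/andP; split=> //; apply/fp; exists i.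
(* The segment starts at a marked position, so [f a] is its joint; the gap after [a] keeps its other
   vertices away from [J']. *)
exists [tuple f (a + i) | i < t.+1].
  split.
  - apply: (@induced_path_of_fun t (fun i => f (a + i))) => i j it jt.
      by move/finj => e; lia.
    by rewrite fadj; lia.
  - apply: disjointWl dis; apply/subsetP => u; rewrite !inE => /mapP[i _ ->].
    by apply/fp; exists (a + i) => //; have := ltn_ord i; lia.
  have /existsP[z /andP[zJ az]] := ma.
  exists (f a); split; first by left; rewrite tnth_mktuple addn0.
    by exists z.
  move=> u y; rewrite !inE => /andP[ua /mapP[i _ eu]] yJ; subst u.
  have i0 : 0 < i.
    by rewrite lt0n; apply: contra ua => /eqP->; rewrite addn0.
  have /gap/existsPn/(_ y) : 0 < i <= t by rewrite i0 -ltnS /=.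
  by rewrite yJ.
apply/subsetP => u; rewrite !inE => /mapP[i _ ->].
by apply/fp; exists (a + i) => //; have := ltn_ord i; lia.
Qed.

(** * Connected sets from paths and walks *)

Lemma connected_path_of_fun t (f : nat -> G) A :
  (forall i, i < t -> adj (f i) (f i.+1)) ->
  (forall u, u \in A <-> exists2 i, i <= t & u = f i) -> connected A.
Proof.
move=> fadj fA; have fin i : i <= t -> f i \in A by move=> it; apply/fA; exists i.
apply: (@connected_via _ (f 0)); first exact: fin.
move=> y /fA[i it ->]; elim: i it => [//|i IHi] it.
apply: connect_trans (IHi (ltnW it)); apply: connect1.
by rewrite /= !fin ?(ltnW it) //= adj_sym fadj.
Qed.

Lemma hangs_connectedU t J (p : t.+1.-tuple G) :
  connected J -> hangs J p -> connected (J :|: [set:: p]).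
Proof.
move=> cJ [indp _ [v [ev [w wJ vw] _]]].
have [f [f0 _ fadj fp]] := path_from_end indp ev.
apply: (connectedU (a := w) (b := v)) => //; last by rewrite adj_sym vw orbT.
  apply: (@connected_path_of_fun t f) => [i it|u]; last by rewrite inE.
  by rewrite fadj ?eqxx // ltnW.
by rewrite inE; apply/fp; exists 0.
Qed.

(** Induction along the walk, stopping as soon as [N] holds. A start outside [N] can be added to the
    set built from the rest of the walk without creating a second vertex in [N]. *)
Lemma walk_first_hit A (N : pred G) x y :
  x \in A -> connect [rel u v in A | adj u v] x y -> N y ->
  exists (Q : {set G}) (q : G),
  [/\ connected Q, x \in Q /\ q \in Q, Q \subset component A x, N q
    & {in Q, forall w, N w -> w = q}].
Proof.
move=> xA /connectP[p]; elim: p x xA => [|z p IHp] x xA /=.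
  move=> _ -> Nx; exists [set x], x; split=> //; rewrite ?set11 //.
  - exact: connected1.
  - by rewrite sub1set inE.
  - by move=> w /set1P.
move=> /andP[/andP[/andP[_ zA] xz] zp] ey Ny.
have [Nx|nNx] := boolP (N x).
  exists [set x], x; split=> //; rewrite ?set11 //.
  - exact: connected1.
  - by rewrite sub1set inE.
  - by move=> w /set1P.
have [Q [q [cQ [zQ qQ] sQ Nq uq]]] := IHp z zA zp ey Ny.
exists (x |: Q), q; split=> //.
- apply: (connectedU (a := x) (b := z)) => //; rewrite ?set11 ?xz ?orbT //.
  exact: connected1.
- by rewrite !inE eqxx qQ orbT.
- apply/subsetP => u /setU1P[->|/(subsetP sQ)]; rewrite !inE //.
  by apply: connect_trans; apply: connect1; rewrite /= xA zA.
- by move=> w /setU1P[->|/uq//]; rewrite (negPf nNx).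
Qed.

(** * Transfer to [G]: creatures of induced subgraphs and legs of claws *)

Lemma creature_of_induced A k t :
  contains_creature (induced A) k t ->
  exists J (P : 'I_k -> t.+1.-tuple G),
  [/\ creature J P, J \subset A & forall i, [set:: P i] \subset A].
Proof.
case=> J [P [[J0 cJ] ind anti jt]].
have disj (B C : {set induced A}) (B' C' : {set G}) :
    B' = val @: B -> C' = val @: C -> [disjoint B & C] -> [disjoint B' & C'].
  move=> -> -> dBC; apply/pred0P => u /=; apply/negP => /andP[].
  move=> /imsetP[b bB ->] /imsetP[c cC /val_inj e]; subst c.
  by move/pred0P/(_ b): dBC; rewrite /= bB cC.
have acomp (B C : {set induced A}) (B' C' : {set G}) :
    B' = val @: B -> C' = val @: C -> anticomplete B C -> anticomplete B' C'.
  by move=> -> -> BC u w /imsetP[b bB ->] /imsetP[c cC ->]; apply: (BC b c).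
have setPE i : [set:: map_tuple val (P i)] = val @: [set:: P i].
  apply/setP => u; rewrite inE; apply/mapP/imsetP => -[w].
    by move=> wP ->; exists w; rewrite ?inE.
  by rewrite inE => wP ->; exists w.
exists (val @: J), (fun i => map_tuple val (P i)); split; last 2 first.
- by apply/subsetP => u /imsetP[w _ ->]; apply: valP.
- by move=> i; rewrite setPE; apply/subsetP => u /imsetP[w _ ->]; apply: valP.
split.
- split.
    by have /set0Pn[u uJ] := J0; apply/set0Pn; exists (val u); apply: imset_f.
  move=> _ _ /imsetP[u uJ ->] /imsetP[v vJ ->].
  have /connectP[p pp ->] := cJ u v uJ vJ.
  apply/connectP; exists (map val p); last by rewrite last_map.
  apply: homo_path pp => a b /andP[/andP[aJ bJ] ab] /=.
  by rewrite !imset_f.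
- move=> i; have [[up padj] dis] := ind i; split; last exact: disj dis.
  split; first by rewrite map_inj_uniq //; apply: val_inj.
  by move=> a b; rewrite !tnth_map -padj.
- move=> i j /anti[d a]; split; first exact: disj d.
  exact: acomp a.
- move=> i; have [v [ev [w wJ vw] a]] := jt i; exists (val v); split.
  + by case: ev => ->; [left|right]; rewrite tnth_map.
  + by exists (val w); rewrite ?imset_f.
  + apply: acomp a => //; rewrite setPE; apply/setP => u; rewrite !inE.
    apply/andP/imsetP => [[uv /imsetP[b bP e]]|[b]].
      exists b => //; rewrite !inE; move: bP uv; rewrite e inE => ->.
      by rewrite andbT (inj_eq val_inj).
    by rewrite !inE => /andP[bv bP] ->; rewrite (inj_eq val_inj) imset_f ?inE.
Qed.

(** [L] consists of the root and the leg through [x]; the two other legs hang from it at their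
    vertices next to the root. *)
Lemma claw_legs t X x :
  isomorphic (induced X) (subdivided_claw t.+1) -> leaf X x ->
  exists L (p1 p2 : t.+1.-tuple G),
  [/\ connected L /\ L \subset X, x \in L, hangs L p1 /\ hangs L p2,
      [set:: p1] \subset X :\ x /\ [set:: p2] \subset X :\ x
    & [disjoint [set:: p1] & [set:: p2]] /\ anticomplete [set:: p1] [set:: p2]].
Proof.
case=> F [g gK Kg] Fadj [xX deg1].
pose h u : G := val (g u).
have hX u : h u \in X by apply: valP.
have hinj : injective h by move=> u v /val_inj /(can_inj Kg).
have hadj u v : adj (h u) (h v) = claw_adj u v.
  by rewrite -[u in RHS]Kg -[v in RHS]Kg; apply/esym/Fadj.
have [u0 xE] : exists u, x = h u.
  by exists (F (Sub x xX)); rewrite /h gK SubK.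
case: u0 xE => [[i0 j0]|] xE; last first.
  (* A leaf is not the root: the first vertices of two legs would be two neighbours of it in [X]. *)
  suff: 1 < #|nbh x :&: X| by rewrite deg1.
  apply/card_gt1P; exists (h (Some (ord0, ord0))), (h (Some (ord_max, ord0))).
  by split; rewrite ?inE ?hX ?xE ?hadj //; apply/eqP => /hinj.
(* Beyond [t] the default of [inord] would repeat a vertex, hence the bounds on indices below. *)
pose f i n : G := h (Some (i, inord n)).
have fadj i j a b : a <= t -> b <= t ->
    adj (f i a) (f j b) = (i == j) && ((a.+1 == b) || (b.+1 == a)).
  by move=> at_ bt; rewrite hadj /= !inordK.
have finj i j a b : a <= t -> b <= t -> f i a = f j b -> i = j /\ a = b.
  move=> at_ bt /hinj[-> /(congr1 val)]; by rewrite /= !inordK.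
have f0 i a : a <= t -> adj (f i a) (h None) = (a == 0).
  by move=> at_; rewrite hadj /= inordK.
have fN i a : f i a <> h None by move/hinj.
pose L := h None |: [set f i0 j | j : 'I_t.+1].
pose p i := [tuple f i j | j < t.+1].
have inp i u : u \in p i -> exists2 a, a <= t & u = f i a.
  by case/mapP=> a _ ->; exists a => //; rewrite -ltnS.
have inL u : u \in L -> u = h None \/ exists2 a, a <= t & u = f i0 a.
  case/setU1P=> [->|/imsetP[a _ ->]]; [by left | right].
  by exists a => //; rewrite -ltnS.
have j0t : j0 <= t by rewrite -ltnS.
have xf : x = f i0 j0 by rewrite xE /f inord_val.
have pX i : i != i0 -> [set:: p i] \subset X :\ x.
  move=> ii0; apply/subsetP => u; rewrite !inE => /inp[a at_ ->].
  by rewrite hX andbT xf; apply: contraNneq ii0 => /finj[] // ->.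
have hangp i : i != i0 -> hangs L (p i).
  move=> ii0; split.
  - by apply: induced_path_of_fun => a b at_ bt; [case/finj | rewrite fadj ?eqxx].
  - apply/pred0P => u /=; rewrite inE; apply/negP => /andP[/inp[a at_ ->]].
    move=> /inL[/fN//|[b bt /finj[]// e]]; by rewrite e eqxx in ii0.
  exists (f i 0); split; first by left; rewrite tnth_mktuple.
    by exists (h None); rewrite ?f0 // setU11.
  move=> u w /setD1P[ua]; rewrite inE => /inp[a at_ eu]; subst u.
  move=> /inL[->|[b bt ->]]; last by rewrite fadj // (negPf ii0).
  by rewrite f0 //; apply: contra ua => /eqP->.
(* Lifting past [i0] yields the two other leg indices. *)
pose i1 : 'I_3 := lift i0 (ord0 : 'I_2); pose i2 : 'I_3 := lift i0 (ord_max : 'I_2).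
have n1 : i1 != i0 by rewrite eq_sym neq_lift.
have n2 : i2 != i0 by rewrite eq_sym neq_lift.
have n12 : i1 != i2 by rewrite (inj_eq lift_inj).
exists L, (p i1), (p i2); split; try by [split; auto].
- split; last first.
    by apply/subsetP => u /inL[->|[a _ ->]]; apply: hX.
  apply: (connectedU (a := h None) (b := f i0 0)); rewrite ?set11 //.
  + exact: connected1.
  + apply: (@connected_path_of_fun t (f i0)) => [a at_|u].
      by rewrite fadj ?eqxx // ltnW.
    split=> [/imsetP[a _ ->]|[a at_ ->]]; first by exists a => //; rewrite -ltnS.
    by apply/imsetP; exists (Ordinal (at_ : a < t.+1)).
  + by apply/imsetP; exists ord0.
  + by rewrite adj_sym f0 ?orbT.
- by rewrite xf; apply/setU1P; right; apply: imset_f.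
- split.
    apply/pred0P => u /=; rewrite !inE; apply/negP => /andP[/inp[a at_ ->]].
    case/inp=> b bt /finj[] // e; by rewrite e eqxx in n12.
  move=> u w; rewrite !inE => /inp[a at_ ->] /inp[b bt ->].
  by rewrite fadj // (negPf n12).
Qed.

End Graphs.

(** * Assembling a larger creature *)

Theorem theorem6p2 (D k t : nat) (G : sgraph) (X : {set G}) (x : G) :
  max_degree_le G D ->
  ~ contains_creature G k t ->
  isomorphic (induced X) (subdivided_claw (t + 1)) ->
  leaf X x ->
  ~ contains_creature
      (induced (component (~: (closed_nbh (X :\ x) :\ x)) x))
      (k - 1) (t * (1 + D)).
Proof.
move=> degD noC; rewrite addn1 => claw leafx.
set A := ~: _; set C := component A x => /creature_of_induced.
have [L [p1 [p2 [[cL sLX] xL [hp1 hp2] [sp1 sp2] [dis12 anti12]]]]] :=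
  claw_legs claw leafx.
(* For [k = 0] the subtraction [k - 1] truncates, but [L] with an empty family is already a
   forbidden creature. *)
case: k noC => [|k] noC.
  case: noC; exists L, (fun _ => p1).
  by split=> // -[].
rewrite subSS subn0 => -[J [P [/creatureP[cJ hP antiP] sJC sPC]]].
have xA : x \in A by rewrite !inE eqxx.
(* A vertex of the component other than [x] is reached by a last step inside [A], so it avoids the
   closed neighbourhood of [X :\ x]. *)
have farC c : c \in C -> c != x ->
    forall y, y \in X -> y != x -> (c != y) && ~~ adj c y.
  rewrite inE => /connectP[w]; elim/last_ind: w => [|w z _] /=.
    by move=> _ ->; rewrite eqxx.
  rewrite rcons_path last_rcons => /andP[_ /andP[/andP[_ zA] _]] -> zx y yX yx.
  move: zA; rewrite !inE zx /= negb_or => /andP[zX zN].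
  apply/andP; split; first by apply: contra zX => /eqP->.
  apply: contra zN => zy; apply/bigcupP; exists y; first by rewrite !inE yx.
  by rewrite inE adj_sym.
pose U := J :|: \bigcup_i [set:: P i].
pose N w := (w \in U) || [exists u in U, adj w u].
have NU u : u \in U -> N u by rewrite /N => ->.
have Nadj w u : u \in U -> adj w u -> N w.
  by move=> uU wu; apply/orP; right; apply/existsP; exists u; rewrite uU.
have JU : J \subset U by apply: subsetUl.
have PU i u : u \in P i -> u \in U.
  by move=> uP; apply/setUP; right; apply/bigcupP; exists i; rewrite ?inE.
have [J0 _] := cJ; have /set0Pn[y yJ] := J0.
have xy : connect [rel u v in A | adj u v] x y.
  by have := subsetP sJC y yJ; rewrite inE.
have [Q [q [cQ [xQ qQ] sQC Nq uq]]] :=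
  walk_first_hit xA xy (NU _ (subsetP JU y yJ)).
have PnotJ i u : u \in P i -> u \notin J.
  have [_ /pred0P dis _] := hP i.
  by move=> uP; have := dis u; rewrite /= inE uP => /negbT.
have Pdisj i j u : i != j -> u \in P i -> u \notin P j.
  move=> /antiP[/pred0P/(_ u)]; rewrite /= !inE => d _ uP.
  by move: d; rewrite uP => /negbT.
(* [E] is [J], or [J] with one of the paths when [q] meets that path;
   [S] holds the indices of the remaining paths. *)
have finish (E : {set G}) (S : pred 'I_k) (e : G) :
    connected E -> J \subset E -> E \subset C -> e \in E -> (q == e) || adj q e ->
    (forall j, S j -> q \notin P j) ->
    (forall j u w, S j -> u \in P j -> w \in E -> w \notin J ->
       (u != w) && ~~ adj u w) ->
    let J' := L :|: (Q :|: E) in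
    [/\ connected J', hangs J' p1, hangs J' p2
      & forall j, S j -> exists2 p : t.+1.-tuple G,
          hangs J' p & [set:: p] \subset [set:: P j] :\ x].
  move=> cE sJE sEC eE qe qP farE J'.
  have sQEC : Q :|: E \subset C by rewrite subUset sQC.
  (* Vertices of [Q :|: E] outside [L] differ from [x], so by [farC] they neither lie on a leg nor
     touch it. *)
  have hleg (p : t.+1.-tuple G) :
      [set:: p] \subset X :\ x -> hangs L p -> hangs J' p.
    move=> spX; move/hangs_mono; apply; first exact: subsetUl.
    move=> u w up; rewrite in_setU => /orP[->//|/(subsetP sQEC) wC] wL.
    have /setD1P[ux uX] : u \in X :\ x by apply: (subsetP spX); rewrite inE.
    have wx : w != x by apply: contraNneq wL => ->.
    by rewrite eq_sym adj_sym farC.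
  split; [|exact: hleg|exact: hleg|].
    apply: (connectedU (a := x) (b := x)); rewrite ?eqxx ?inE ?xQ //.
    exact: (connectedU (a := q) (b := e)).
  move=> j Sj.
  (* A vertex of [Q] on [P j] would satisfy [N] and hence be [q], which avoids [P j]; the walk
     starts at [x]. *)
  have xPj : x \notin P j.
    by apply/negP => xP; have := qP j Sj; rewrite -(uq x xQ) ?xP // NU // (PU j).
  have PjC u : u \in P j -> u \in C /\ u != x.
    move=> uP; split; first by apply: (subsetP (sPC j)); rewrite inE.
    by apply: contraNneq xPj => <-.
  have QPj u : u \in Q -> u \notin P j.
    move=> uQ; apply/negP => uP; move: (qP j Sj).
    by rewrite -(uq u) ?uP // NU // (PU j).
  have [|||p hp sp] := @hangs_shorten _ t (1 + D) J J' (P j) (hP j).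
  - by apply: subset_trans sJE _; rewrite /J' setUA subsetUr.
  - apply/pred0P => u; rewrite /= inE; apply/negP => /andP[uP].
    have [uC ux] := PjC u uP; rewrite !in_setU => /or3P[uL|uQ|uE].
    + have := farC u uC ux u (subsetP sLX u uL) ux; by rewrite eqxx.
    + by have := QPj u uQ; rewrite uP.
    + by have := farE j u u Sj uP uE (PnotJ j u uP); rewrite eqxx.
  (* The bound [1 + D] counts the joint [v], for contacts with [J], and the neighbours of [q]. A
     contact in [Q] satisfies [N], so it is [q]; a contact in [L] can only be [x], which lies in
     [Q]; [E] outside [J] has none. *)
  - have [_ _ [v [_ _ antiv]]] := hP j.
    apply: leq_trans (_ : #|v |: nbh q| <= _); last first.
      by rewrite cardsU1 leq_add ?leq_b1.
    apply/subset_leq_card/subsetP => u; rewrite inE.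
    move=> /andP[uP /existsP[w /andP[]]]; rewrite in_setU1 [u \in nbh q]inE.
    have [uC ux] := PjC u uP.
    have adjQ : w \in Q -> adj u w -> (u == v) || adj q u.
      move=> wQ uw; rewrite -(uq w wQ) 1?adj_sym ?uw ?orbT //.
      by rewrite (Nadj w u) ?(PU j) // adj_sym.
    rewrite !in_setU => /or3P[wL|//|wE] uw.
    + have [wx|wx] := eqVneq w x; first by apply: adjQ => //; rewrite wx.
      by have := farC u uC ux w (subsetP sLX w wL) wx; rewrite uw andbF.
    have [wJ|wJ] := boolP (w \in J); last first.
      by have := farE j u w Sj uP wE wJ; rewrite uw andbF.
    have [//|uv] := eqVneq u v.
    by have := antiv u w; rewrite !inE uv uP uw => /(_ isT wJ).
  exists p => //; apply/subsetP => u up; have := subsetP sp u up.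
  by rewrite !inE => /PjC[uC ->]; move: up => /(subsetP sp); rewrite inE.
have farleg (p p' : t.+1.-tuple G) j : [set:: p] \subset X :\ x ->
    [set:: p'] \subset [set:: P j] :\ x ->
    [disjoint [set:: p] & [set:: p']] /\ anticomplete [set:: p] [set:: p'].
  move=> spX spP.
  have far u w : u \in [set:: p] -> w \in [set:: p'] -> (w != u) && ~~ adj w u.
    move=> /(subsetP spX)/setD1P[ux uX] /(subsetP spP)/setD1P[wx wP].
    by apply: farC => //; apply: (subsetP (sPC j)).
  split; last by move=> u w up wp; have /andP[] := far u w up wp; rewrite adj_sym.
  apply/pred0P => u; apply/negP => /andP[up up'].
  by have := far u u up up'; rewrite eqxx.
have farPP (p p' : t.+1.-tuple G) i j : i != j ->
    [set:: p] \subset [set:: P i] :\ x -> [set:: p'] \subset [set:: P j] :\ x ->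
    [disjoint [set:: p] & [set:: p']] /\ anticomplete [set:: p] [set:: p'].
  move=> /antiP[dis anti] sp sp'; split.
    apply: disjointWl (subset_trans sp (subsetDl _ _)) _.
    exact: disjointWr (subset_trans sp' (subsetDl _ _)) _.
  by move=> u w /(subsetP sp)/setD1P[_ uP] /(subsetP sp')/setD1P[_ wP]; apply: anti.
(* The absorbed path gives up index [i], which [p2] takes over; [p1] is then added as a new index,
   so the family has [k.+1] paths. *)
have absorb i e : e \in P i -> (q == e) || adj q e ->
    (forall j, j != i -> q \notin P j) -> False.
  move=> eP qe qP.
  have [] := finish (J :|: [set:: P i]) (fun j => j != i) e.
  - exact: hangs_connectedU.
  - exact: subsetUl.
  - by rewrite subUset sJC sPC.
  - by rewrite !inE eP orbT.
  - exact: qe.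
  - exact: qP.
  - move=> j u w ji uP; rewrite !inE => /orP[->//|wP] _.
    have [_ anti] := antiP j i ji; apply/andP; split.
      by apply: contraTneq wP => <-; apply: Pdisj ji uP.
    by apply: anti; rewrite inE.
  move=> cJ' h1 h2 hj.
  have [P' P'P] : exists P' : 'I_k -> t.+1.-tuple G, forall j,
      hangs (L :|: (Q :|: (J :|: [set:: P i]))) (P' j) /\
      (if j == i then P' j = p2 else [set:: P' j] \subset [set:: P j] :\ x).
    apply: (fin_all_exists (P := fun j p => hangs _ p /\
      (if j == i then p = p2 else [set:: p] \subset [set:: P j] :\ x))) => j.
    case: eqVneq => [_|ji]; first by exists p2.
    by have [p] := hj j ji; exists p.
  apply: noC; apply: (creature_cons (P := P') cJ' h1).
  - by move=> j; case: (P'P j).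
  - move=> j; have [_] := P'P j; case: eqVneq => [_ -> //|_]; exact: farleg.
  move=> j l jl; have [_] := P'P j; have [_] := P'P l.
  case: eqVneq => [li|_]; case: eqVneq => [ji|_].
  - by rewrite li ji eqxx in jl.
  - move=> -> /(farleg _ _ _ sp2)[]; rewrite disjoint_sym => dis.
    by move/anticomplete_sym.
  - by move=> sl ->; apply: farleg sp2 sl.
  - by move=> sl sj; apply: farPP jl sj sl.
(* Paths are disjoint, so if [q] lies on one of them it lies on no other, as [absorb] demands. *)
have [/existsP[i qi]|/existsPn qPj] := boolP [exists i, q \in P i].
  apply: (absorb i q) => //; first by rewrite eqxx.
  by move=> j ji; apply: Pdisj qi; rewrite eq_sym.
have [[e eJ qe]|[i [e eP qe]]] :
    (exists2 e, e \in J & (q == e) || adj q e) \/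
    (exists i, exists2 e, e \in P i & (q == e) || adj q e).
- have [u uU qu] : exists2 u, u \in U & (q == u) || adj q u.
    case/orP: Nq => [qU|/existsP[u /andP[uU qu]]].
      by exists q; rewrite ?eqxx.
    by exists u; rewrite ?qu ?orbT.
  case/setUP: uU => [uJ|/bigcupP[i _]]; first by left; exists u.
  by rewrite inE => uP; right; exists i, u.
(* With nothing absorbed, all [k] paths survive in shortened form and [p1] supplies the additional
   one. *)
- have [] := finish J predT e => //.
    by move=> j u w _ _ ->.
  move=> cJ' h1 _ hj.
  have [P' P'P] : exists P' : 'I_k -> t.+1.-tuple G, forall j,
      hangs (L :|: (Q :|: J)) (P' j) /\ [set:: P' j] \subset [set:: P j] :\ x.
    apply: (fin_all_exists (P := fun j p => hangs _ p /\
      [set:: p] \subset [set:: P j] :\ x)) => j.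
    by have [p] := hj j isT; exists p.
  apply: noC; apply: (creature_cons (P := P') cJ' h1).
  - by move=> j; case: (P'P j).
  - by move=> j; have [_] := P'P j; apply: farleg.
  by move=> j l jl; have [_ sj] := P'P j; have [_ sl] := P'P l; apply: farPP sj sl.
- exact: (absorb i e).
Qed.
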